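(* For every integer $n\geq1$, the length-$n$ constant schedule $(h_n,\ldots,h_n)$ is $s$-composable with rate $\eta_n$. In particular, every $f\in\mathcal{F}_{0,1}$, every $x_*\in\arg\min f$, and every trajectory $x_{i+1}=x_i-h_n\nabla f(x_i)$, $i=0,\ldots,n-1$ (with arbitrary $x_0$), satisfy $$\frac{1-\eta_n}{2}\|\nabla f(x_n)\|^2+\frac{\eta_n^2}{2}\|x_n-x_*\|^2+\eta_n(1-\eta_n)(f(x_n)-f_* )\leq\frac{\eta_n^2}{2}\|x_0-x_*\|^2.$$
   Context: Norms are Euclidean. Let $\mathcal{F}_{0,1}$ be the class of differentiable convex functions $f:\mathbb{R}^d\to\mathbb{R}$ (any dimension $d$) whose gradient is $1$-Lipschitz and whose minimizer set is nonempty; write $f_*=\min f$. Constants. For $n\geq1$, $r_n\in(0,1)$ is the unique solution in $(0,1)$ of $r_n^n\bigl(1+n(1+r_n)\bigr)=1$ (the left-hand side is continuous and strictly increasing in $r_n\in[0,1]$, equals $0$ at $0$ and exceeds $1$ at $1$). Set $h_n=1+r_n$ and $\eta_n=r_n^n=\frac{1}{1+nh_n}$. Definition ($s$-composability). A positive schedule $(h_0,\ldots,h_{N-1})$ (all entries $>0$) is $s$-composable with rate $\eta$ if $$\eta=\frac{1}{1+\sum_{k=0}^{N-1}h_k}=\prod_{k=0}^{N-1}(h_k-1)$$ and, for every $f\in\mathcal{F}_{0,1}$, every $x_*\in\arg\min f$ and every $x_0$, the iterates $x_{k+1}=x_k-h_k\nabla f(x_k)$, $k=0,\ldots,N-1$,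 satisfy $$\frac{1-\eta}{2}\|\nabla f(x_N)\|^2+\frac{\eta^2}{2}\|x_N-x_*\|^2+\eta(1-\eta)(f(x_N)-f_* )\leq\frac{\eta^2}{2}\|x_0-x_*\|^2.$$ (In this definition $h_k$ is the $k$-th entry of the schedule; in the theorem all $n$ entries equal the constant $h_n=1+r_n$, where $r_n$ is the unique solution in $(0,1)$ of $r_n^n\bigl(1+n(1+r_n)\bigr)=1$.) *)

(* Defs.v *)
From HB Require Import structures.
From mathcomp Require Import all_boot all_order all_algebra.
From mathcomp Require Import all_classical all_reals all_analysis.
Import Order.TTheory GRing.Theory Num.Theory.
Import numFieldNormedType.Exports.

Set Implicit Arguments.
Unset Strict Implicit.
Unset Printing Implicit Defensive.

Local Open Scope classical_set_scope.
Local Open Scope ring_scope.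

(* The library norm `|x| on row vectors is the sup norm, hence a separate
   Euclidean norm; the two induce the same topology, so the library's notion of
   differentiability applies unchanged. *)
Definition enorm (R : realType) (d : nat) (x : 'rV[R]_d) : R :=
  Num.sqrt (\sum_i x ord0 i ^+ 2).

Definition grad (R : realType) (d : nat) (f : 'rV[R]_d -> R) (x : 'rV[R]_d) :
    'rV[R]_d :=
  \row_i 'D_(delta_mx ord0 i) f x.

Lemma diff_grad (R : realType) (d : nat) (f : 'rV[R]_d -> R) (x v : 'rV[R]_d) :
  differentiable f x -> 'd f x v = \sum_i grad f x ord0 i * v ord0 i.
Proof.
move=> df; rewrite {1}(row_sum_delta v) linear_sum; apply: eq_bigr => i _.
by rewrite linearZ mxE deriveE //= mulrC.
Qed.

Definition argmin (R : realType) (d : nat) (f : 'rV[R]_d -> R) :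
    set 'rV[R]_d :=
  [set x | forall y, f x <= f y].

(* The infimum is attained as soon as argmin f is nonempty, see minvalE. *)
Definition minval (R : realType) (d : nat) (f : 'rV[R]_d -> R) : R :=
  inf (range f).

Lemma minvalE (R : realType) (d : nat) (f : 'rV[R]_d -> R) (x : 'rV[R]_d) :
  argmin f x -> minval f = f x.
Proof.
move=> fx; apply/eqP; rewrite eq_le; apply/andP; split.
  by apply: ge_inf; [exists (f x) => _ [y _ <-]; exact: fx | exists x].
by apply: lb_le_inf; [exists (f x), x | move=> _ [y _ <-]; exact: fx].
Qed.

(* The indices are the strong convexity modulus 0 and the smoothness constant 1. *)
Record F01 (R : realType) (d : nat) (f : 'rV[R]_d -> R) : Prop := {
  F01_convex : convex_function setT f ;
  F01_differentiable : forall x, differentiable f x ;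
  F01_grad_lipschitz : forall x y,
    enorm (grad f x - grad f y) <= enorm (x - y) ;
  F01_argmin : argmin f !=set0
}.

(* Only the values x 0, ..., x (size h) are constrained. *)
Definition gd_trajectory (R : realType) (d : nat) (f : 'rV[R]_d -> R)
    (h : seq R) (x : nat -> 'rV[R]_d) : Prop :=
  forall k, (k < size h)%N -> x k.+1 = x k - h`_k *: grad f (x k).

Definition s_composable (R : realType) (h : seq R) (eta : R) : Prop :=
  [/\ {in h, forall t, 0 < t},
      eta = 1 / (1 + \sum_(t <- h) t),
      eta = \prod_(t <- h) (t - 1) &
      forall (d : nat) (f : 'rV[R]_d -> R) (xs : 'rV[R]_d)
             (x : nat -> 'rV[R]_d),
        F01 f -> argmin f xs -> gd_trajectory f h x ->
        let N := size h in
        (1 - eta) / 2 * enorm (grad f (x N)) ^+ 2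
        + eta ^+ 2 / 2 * enorm (x N - xs) ^+ 2
        + eta * (1 - eta) * (f (x N) - minval f)
        <= eta ^+ 2 / 2 * enorm (x 0%N - xs) ^+ 2].

Definition is_rstar (R : realType) (n : nat) (r : R) : Prop :=
  0 < r < 1 /\ r ^+ n * (1 + n%:R * (1 + r)) = 1.

(* For n = 0 every r in (0,1) satisfies is_rstar; only n >= 1 is meaningful. *)
Definition rstar (R : realType) (n : nat) : R := xget 0 [set r | is_rstar n r].

Definition hstar (R : realType) (n : nat) : R := 1 + rstar R n.

(* By is_rstar this equals 1 / (1 + n * hstar n) for n >= 1. *)
Definition etastar (R : realType) (n : nat) : R := rstar R n ^+ n.

Lemma is_rstar_unique (R : realType) (n : nat) (r s : R) :
  (0 < n)%N -> is_rstar n r -> is_rstar n s -> r = s.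
Proof.
move=> n0.
suff H (a b : R) : is_rstar n a -> is_rstar n b -> ~~ (a < b).
  move=> hr hs; apply/eqP; rewrite eq_le !leNgt.
  by rewrite (H _ _ hr hs) (H _ _ hs hr).
move=> [/andP[a0 _] ea] [/andP[b0 _] eb]; apply/negP => ab.
have n0R : 0 < n%:R :> R by rewrite ltr0n.
suff : a ^+ n * (1 + n%:R * (1 + a)) < b ^+ n * (1 + n%:R * (1 + b)).
  by rewrite ea eb ltxx.
apply: ltr_pM.
- by rewrite exprn_ge0 // ltW.
- by rewrite addr_ge0 // mulr_ge0 ?addr_ge0 // ltW.
- by rewrite ltrXn2r ?gtn_eqF //; apply: ltW.
- by rewrite ltrD2l ltr_pM2l // ltrD2l.
Qed.

Lemma is_rstar_exists (R : realType) (n : nat) :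
  (0 < n)%N -> exists r : R, is_rstar n r.
Proof.
move=> n0; pose p : {poly R} := 'X^n * (1 + n%:R *: (1 + 'X)) - 1.
have pE r : p.[r] = r ^+ n * (1 + n%:R * (1 + r)) - 1.
  by rewrite /p !hornerE.
have n0R : 0 < n%:R :> R by rewrite ltr0n.
have p0 : p.[0] = -1 by rewrite pE expr0n gtn_eqF // mul0r sub0r.
have p1 : 0 < p.[1].
  by rewrite pE expr1n mul1r addrAC subrr add0r mulr_gt0 // addr_gt0.
have [|r /andP[r0 r1] /rootP pr] := @poly_ivt _ p 0 1 ler01.
  by rewrite p0 lerN10 ltW.
exists r; split; last by apply/eqP; rewrite -subr_eq0 -pE pr.
apply/andP; split; rewrite lt_neqAle ?r0 ?r1 andbT.
  by apply/eqP => r0E; move: pr; rewrite -r0E p0 => /eqP; rewrite oppr_eq0 oner_eq0.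
by apply/eqP => r1E; move: p1; rewrite -r1E pr ltxx.
Qed.

Lemma rstarP (R : realType) (n : nat) : (0 < n)%N -> is_rstar n (rstar R n).
Proof. by move=> /(@is_rstar_exists R) /(xgetPex 0). Qed.

(* Main.v *)
Require Import Defs.
From mathcomp Require Import all_boot all_order all_algebra.
From mathcomp Require Import all_classical all_reals all_analysis.
From mathcomp Require Import ring lra zify.
Import Order.TTheory GRing.Theory Num.Theory.
Import numFieldNormedType.Exports.
Local Open Scope ring_scope.

(** Write [h = 1 + r], [g k] for the gradient at [x k] and [Q i j >= 0] for the
    interpolation inequality of smooth convex functions at [x i], [x j].
    Adding the [Q] between the minimizer and each of [x 0, ..., x (n-1)] makes
    the distances to the minimizer telescope and reduces the claim to
      [\sum_(k < n) (f (x k) - f (x n))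
         >= r / 2 * \sum_(k < n) |g k|^2 + n / 2 * r^-n * |g n|^2].
    The difference of the two sides is exactly a nonnegative combination of the
    [Q i j] with [i, j <= n], without any leftover square. The multipliers come
    from two sequences [0 <= dist_coef k <= grad_coef k], with [dist_coef]
    nondecreasing: the fan [h * \sum_(k < m < n) Q k m + Q k n] gets
    [dist_coef (k+1) - dist_coef k], the pair [Q k (k+1) + r * Q (k+1) k] gets
    [grad_coef (k+1) - dist_coef (k+1)], and [Q n k] gets
    [r * dist_coef (k+1) + dist_coef k]. Monotonicity of [dist_coef] follows
    from truncating the binomial series of [(1 - c)^-d] with [c = 1 - r^2]; the
    bound [dist_coef <= grad_coef] is [r^-d <= 1 + d h] for [d <= n], where the
    balance [r^-n = 1 + n h] enters. *)

Set Implicit Arguments.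
Unset Strict Implicit.
Unset Printing Implicit Defensive.

(** * Multiplier sequences: recurrences, monotonicity and signs *)

Section Weights.
Variables (R : realFieldType) (r : R).
Hypotheses (r0 : 0 < r) (r1 : r < 1).

(** The solution of the recurrence [grad_coefS] that starts at 0. *)
Definition grad_coef (k : nat) : R := ((r ^- 2) ^+ k - 1) / (2 * (1 + r)).

(* Division by 0 gives [slack n n = 0], so [dist_coef n n = grad_coef n]; any
   value of [dist_coef n n] between [dist_coef n (n-1)] and [grad_coef n] would
   do, since it cancels in the certificate. *)
Definition slack (n k : nat) : R :=
  ((r ^- 2) ^+ k * (1 + (n - k)%:R * (1 + r)) ^+ 2 - (r ^- 2) ^+ n)
  / (2 * (1 + r) ^+ 3 * (n - k)%:R * ((n - k)%:R + 1)).

Definition dist_coef (n k : nat) : R := grad_coef k - slack n k.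

Let h0 : 0 < 1 + r. Proof. by rewrite addr_gt0. Qed.
Let hN0 : 1 + r != 0. Proof. by rewrite gt_eqF. Qed.
Let rN0 : r != 0. Proof. by rewrite gt_eqF. Qed.

(** In [potential_step] this cancels the coefficient of [|g k|^2]. *)
Lemma grad_coefS k : r ^+ 2 * grad_coef k.+1 = grad_coef k + (1 - r) / 2.
Proof.
rewrite /grad_coef (exprS _ k); move: (_ ^+ k) => X; field.
by rewrite rN0 hN0.
Qed.

(** In [potential_step] this cancels the coefficient of [phi k - phi n]. *)
Lemma dist_coef_rec n k : (k < n)%N ->
  (1 + r) * ((n - k.+1)%:R * dist_coef n k.+1
             - ((n - k.+1)%:R + 2) * dist_coef n k)
  + (1 - r) * (grad_coef k.+1 - grad_coef k) = 1.
Proof.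
move=> kn; rewrite /dist_coef /slack /grad_coef.
have -> : (n - k = (n - k.+1).+1)%N by rewrite subnSK.
have -> : (r ^- 2) ^+ n =
    (r ^- 2) ^+ k * (r ^- 2) ^+ (n - k.+1) * (r ^- 2) :> R.
  by rewrite -exprD -exprSr; congr (_ ^+ _); lia.
rewrite (exprS _ k); move: (_ ^+ k) => X.
case: (n - k.+1)%N => [|d].
  by rewrite expr0 mulr0n !(mulr0, mul0r); field; rewrite rN0 hN0.
rewrite -(natr1 d.+1) -(natr1 d); move: (_ ^+ d.+1) (ler0n R d) => Y.
set e := d%:R => e0.
field; rewrite ?rN0 ?hN0 /=.
by apply/andP; split; rewrite gt_eqF //; lra.
Qed.

Lemma expr_ge_quadratic d :
  1 + d%:R * (1 - r ^+ 2) + d%:R * (d%:R + 1) / 2 * (1 - r ^+ 2) ^+ 2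
  <= (r ^- 2) ^+ d.
Proof.
set c := 1 - r ^+ 2.
have c0 : 0 < c by rewrite /c subr_gt0 expr_lt1 ?ltW.
have r2 : 0 < r ^+ 2 by rewrite exprn_gt0.
elim: d => [|d IH]; first by rewrite expr0; lra.
rewrite (exprS _ d) -[leRHS]mulrC ler_pdivlMr //.
apply: le_trans IH; rewrite -natr1; have := ler0n R d; set e := d%:R => e0.
have -> : r ^+ 2 = 1 - c by rewrite /c; ring.
rewrite -subr_ge0.
(* Multiplying the truncation for [e + 1] by [1 - c] gives the one for [e], less a nonnegative
   multiple of [c ^+ 3]. *)
rewrite [leRHS](_ : _ = (e + 1) * (e + 2) / 2 * c ^+ 3); last by field.
by rewrite !mulr_ge0 ?exprn_ge0 ?(ltW c0) ?invr_ge0 ?ler0n //; lra.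
Qed.

(** The increment is a positive multiple of the gap in [expr_ge_quadratic] for the exponent
    [n - k - 1]. The case [k + 1 = n] is separate, because [slack n n = 0] is only a convention. *)
Lemma dist_coef_le n k : (k < n)%N -> dist_coef n k <= dist_coef n k.+1.
Proof.
move=> kn; rewrite /dist_coef /slack /grad_coef.
have := expr_ge_quadratic (n - k.+1).
have -> : (n - k = (n - k.+1).+1)%N by rewrite subnSK.
have -> : (r ^- 2) ^+ n =
    (r ^- 2) ^+ k * (r ^- 2) ^+ (n - k.+1) * (r ^- 2) :> R.
  by rewrite -exprD -exprSr; congr (_ ^+ _); lia.
rewrite (exprS _ k).
have : 0 < (r ^- 2) ^+ k by rewrite exprn_gt0 // invr_gt0 exprn_gt0.
move: (_ ^+ k) => X X0.
case: (n - k.+1)%N => [|d].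
  rewrite expr0 mulr0n !(mulr0, mul0r) => _; rewrite -subr_ge0 invr0.
  rewrite [leRHS](_ : _ = X * (1 + r * (2 - r)) / (4 * r ^+ 2 * (1 + r)));
    last first.
    by field; rewrite rN0 hN0.
  have r2 : 0 <= 2 - r by move: r1; lra.
  rewrite divr_ge0 // mulr_ge0 ?(ltW X0) ?(ltW h0) //.
    by rewrite addr_ge0 ?mulr_ge0 ?(ltW r0).
  by rewrite mulr_ge0 ?exprn_ge0 ?(ltW r0).
rewrite -(natr1 d.+1) -(natr1 d); move: (_ ^+ d.+1) (ler0n R d) => Y.
set e := d%:R => e0 HY.
rewrite -subr_ge0.
rewrite [leRHS](_ : _ = X * (Y - (1 + (e + 1) * (1 - r ^+ 2) +
  (e + 1) * (e + 1 + 1) / 2 * (1 - r ^+ 2) ^+ 2)) /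
   (r ^+ 2 * (1 + r) ^+ 3 * (e + 1) * (e + 2) * (e + 3))); last first.
  field; rewrite ?rN0 ?hN0 /=.
  by apply/and3P; split; rewrite gt_eqF //; lra.
apply: divr_ge0; first by rewrite mulr_ge0 ?subr_ge0 // ltW.
by rewrite !mulr_ge0 ?exprn_ge0 ?addr_ge0 // ltW.
Qed.

Section Balanced.
Variable n : nat.
Hypothesis rn : r ^+ n * (1 + n%:R * (1 + r)) = 1.

(* [r ^ d (1 + d h)] increases and then decreases in [d], and equals 1 at both
   ends [0] and [n]. *)
Lemma expr_le_affine d : (d <= n)%N -> 1 <= r ^+ d * (1 + d%:R * (1 + r)).
Proof.
pose s k : R := r ^+ k * (1 + k%:R * (1 + r)).
have sS k :
    s k.+1 - s k = r ^+ k * (r * (1 + r) - (1 - r) * (1 + k%:R * (1 + r))).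
  by rewrite /s (exprS _ k) -natr1; ring.
have rk k : 0 < r ^+ k by rewrite exprn_gt0.
rewrite -/(s d) => dn; rewrite leNgt; apply/negP => sd.
have [k kd sk] : exists2 k, (k < d)%N & s k.+1 < s k.
  apply: contrapT => H; suff : forall k, (k <= d)%N -> 1 <= s k.
    by move=> /(_ d (leqnn d)); rewrite leNgt sd.
  elim=> [_|k IH kd]; first by rewrite /s mul0r addr0 mulr1.
  apply: le_trans (IH (ltnW kd)) _; rewrite leNgt; apply/negP => sk.
  by apply: H; exists k.
(* After the drop at [k] the sequence never rises again, so a value below 1 at [d] would force
   [s n < 1], against the balance. *)
suff : forall m, (d + m <= n)%N -> s (d + m)%N < 1.
  by move=> /(_ (n - d)%N); rewrite subnKC // leqnn /s rn ltxx => /(_ isT).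
elim=> [|m IH dm]; first by rewrite addn0.
rewrite addnS in dm *; apply: le_lt_trans (IH (ltnW dm)).
rewrite -subr_le0 sS pmulr_rle0 //.
move: sk; rewrite -subr_lt0 sS pmulr_rlt0 //.
rewrite !subr_lt0 !subr_le0 => /ltW/le_trans; apply.
rewrite ler_pM2l ?subr_gt0 // lerD2l ler_pM2r // ler_nat.
by rewrite (leq_trans (ltnW kd)) // leq_addr.
Qed.

Lemma balanced_sqr : (r ^- 2) ^+ n = (1 + n%:R * (1 + r)) ^+ 2.
Proof.
have rn0 : r ^+ n != 0 by rewrite expf_neq0.
rewrite (_ : 1 + _ = r ^- n); first by rewrite !exprVn -!exprM mulnC.
by apply: (mulfI rn0); rewrite rn divff.
Qed.

(** With [(r ^- 2) ^+ k] factored out, the numerator is nonnegative by the square of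
    [expr_le_affine] at [n - k]. *)
Lemma slack_ge0 k : (k <= n)%N -> 0 <= slack n k.
Proof.
move=> kn; rewrite /slack; have := expr_le_affine (leq_subr k n).
have -> : (r ^- 2) ^+ n = (r ^- 2) ^+ k * (r ^- 2) ^+ (n - k) :> R.
  by rewrite -exprD subnKC.
have d0 := ler0n R (n - k); move: (n - k)%N d0 => d d0 rd; rewrite -mulrBr.
have rd0 : 0 < r ^+ d by rewrite exprn_gt0.
apply: divr_ge0; last by rewrite !mulr_ge0 ?exprn_ge0 ?addr_ge0 // ltW.
rewrite mulr_ge0 ?exprn_ge0 ?invr_ge0 ?exprn_ge0 ?(ltW r0) // subr_ge0.
rewrite exprVn -exprM mulnC exprM -exprVn.
rewrite lerXn2r ?nnegrE ?invr_ge0 ?(ltW rd0) //.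
  by rewrite addr_ge0 // mulr_ge0 // ltW.
by rewrite -[_^-1]mul1r ler_pdivrMr // mulrC.
Qed.

Lemma dist_coef0 : dist_coef n 0 = 0.
Proof.
rewrite /dist_coef /grad_coef /slack expr0 subrr mul1r subn0.
by rewrite balanced_sqr subrr !mul0r subrr.
Qed.

Lemma dist_coef_ge0 k : (k <= n)%N -> 0 <= dist_coef n k.
Proof.
elim: k => [|k IH] kn; first by rewrite dist_coef0.
exact: le_trans (IH (ltnW kn)) (dist_coef_le kn).
Qed.

(** Passing from [phi] back to [F] in [sum_gap_ge] uses up the part [n / 2], leaving the weight
    [n / 2 * r ^- n] on [|g n|^2]. *)
Lemma grad_coef_balanced : grad_coef n = n%:R * (1 + r ^- n) / 2.
Proof.
have rn0 : r ^+ n != 0 by rewrite expf_neq0.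
have -> : r ^- n = 1 + n%:R * (1 + r).
  by apply: (mulfI rn0); rewrite rn divff.
by rewrite /grad_coef balanced_sqr; field.
Qed.

End Balanced.
End Weights.

(** * The Euclidean inner product *)

Section Dot.
Variables (R : comNzRingType) (d : nat).
Implicit Types x y z : 'rV[R]_d.

Definition dot x y : R := \sum_i x ord0 i * y ord0 i.

Lemma dotC x y : dot x y = dot y x.
Proof. by apply: eq_bigr => i _; rewrite mulrC. Qed.

Lemma dotDl x y z : dot (x + y) z = dot x z + dot y z.
Proof. by rewrite -big_split; apply: eq_bigr => i _; rewrite mxE mulrDl. Qed.

Lemma dotZl a x y : dot (a *: x) y = a * dot x y.
Proof. by rewrite mulr_sumr; apply: eq_bigr => i _; rewrite mxE mulrA. Qed.

Lemma dotNl x y : dot (- x) y = - dot x y.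
Proof. by rewrite -scaleN1r dotZl mulN1r. Qed.

Lemma dotDr x y z : dot x (y + z) = dot x y + dot x z.
Proof. by rewrite dotC dotDl !(dotC x). Qed.

Lemma dotZr a x y : dot x (a *: y) = a * dot x y.
Proof. by rewrite dotC dotZl dotC. Qed.

Lemma dotNr x y : dot x (- y) = - dot x y.
Proof. by rewrite dotC dotNl dotC. Qed.

Lemma dot0l x : dot 0 x = 0.
Proof. by rewrite -(scale0r 0) dotZl mul0r. Qed.

Lemma dot_suml (m n : nat) (F : nat -> 'rV[R]_d) y :
  dot (\sum_(m <= k < n) F k) y = \sum_(m <= k < n) dot (F k) y.
Proof.
by elim/big_rec2: _ => [|k a b _ <-]; rewrite ?dot0l ?dotDl.
Qed.

Definition dotE := (dotDl, dotDr, dotNl, dotNr, dotZl, dotZr).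

End Dot.

(** * The combination of interpolation inequalities, as a telescoping potential *)

Section Certificate.
Variables (R : realFieldType) (r : R) (d n : nat).
Hypotheses (r0 : 0 < r) (r1 : r < 1).
Hypothesis rn : r ^+ n * (1 + n%:R * (1 + r)) = 1.
Variables (x g : nat -> 'rV[R]_d) (phi : nat -> R).
Hypothesis xS : forall k, (k < n)%N -> x k.+1 = x k - (1 + r) *: g k.
Let p k := x k - g k.
Let Q i j := phi i - phi j - dot (g j) (p i - p j).
Hypothesis Q_ge0 : forall i j, (i <= n)%N -> (j <= n)%N -> 0 <= Q i j.

Let z k := p k - p n.
Let Y k := (1 + r) * \sum_(k <= m < n) Q n m.
(** The potential is [Psi k + dist_coef r n k * Y k]. It is 0 at [k = 0] and
    [- grad_coef r n * |g n|^2] at [k = n]. *)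
Let Psi k := - (1 - r) * slack r n k * (phi k - phi n)
  - grad_coef r k * dot (g k) (g k)
  - 2 * dist_coef r n k * dot (g k) (z k) - dist_coef r n k * dot (z k) (z k).

(* The right-hand side is [(1 + r) * \sum_(k < m < n) Q k m + Q k n]: the part
   that does not involve [k] is stored in [Y], which makes the rest local. *)
Lemma fan_ge0 k : (k < n)%N ->
  0 <= Y k.+1 + ((1 + r) * (n - k.+1)%:R + 1) * (phi k - phi n)
       - dot (z k - r *: g k) (z k).
Proof.
move=> kn.
have Qnk m : Q k m = Q n m + (phi k - phi n) - dot (g m) (z k).
  by rewrite /Q /z !dotE; ring.
(* The left side is [x k.+1 - x n + g n], and the steps from [k + 1] to [n] telescope. *)
have -> : z k - r *: g k = (1 + r) *: \sum_(k.+1 <= m < n) g m + g n.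
  have -> : (1 + r) *: \sum_(k.+1 <= m < n) g m = x k.+1 - x n.
    rewrite scaler_sumr -opprB -telescope_sumr // -sumrN.
    by apply: eq_big_nat => m /andP[_ mn]; rewrite opprB xS // subKr.
  rewrite /z /p xS //; apply/rowP => i; rewrite !mxE; ring.
suff <- : (1 + r) * (\sum_(k.+1 <= m < n) Q k m) + Q k n = Y k.+1 +
  ((1 + r) * (n - k.+1)%:R + 1) * (phi k - phi n) -
  dot ((1 + r) *: \sum_(k.+1 <= m < n) g m + g n) (z k).
  apply: addr_ge0; last exact: (Q_ge0 (ltnW kn) (leqnn n)).
  apply: mulr_ge0.
    by rewrite addr_ge0 // ltW.
  rewrite big_nat sumr_ge0 // => m /andP[_ /ltnW mn].
  exact: Q_ge0 (ltnW kn) mn.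
under eq_bigr do rewrite Qnk.
rewrite !sumrB big_split /= sumr_const_nat /Y dotDl dotZl dot_suml Qnk.
have -> : Q n n = 0.
  by rewrite /Q !subrr /dot big1 ?subrr // => i _; rewrite mxE mulr0.
by rewrite -mulr_natl; ring.
Qed.

Lemma potential_step k : (k < n)%N ->
  Psi k + dist_coef r n k * Y k <= phi k - phi n + (1 - r) / 2 * dot (g k) (g k)
    + (Psi k.+1 + dist_coef r n k.+1 * Y k.+1).
Proof.
move=> kn; have kn' := ltnW kn; have fan0 := fan_ge0 kn; rewrite -subr_ge0.
set fan := (X in 0 <= X) in fan0.
suff -> : phi k - phi n + (1 - r) / 2 * dot (g k) (g k)
  + (Psi k.+1 + dist_coef r n k.+1 * Y k.+1) - (Psi k + dist_coef r n k * Y k)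
  = (dist_coef r n k.+1 - dist_coef r n k) * fan
    + slack r n k.+1 * (Q k k.+1 + r * Q k.+1 k)
    + (r * dist_coef r n k.+1 + dist_coef r n k) * Q n k.
  have w0 m : (m <= n)%N -> 0 <= dist_coef r n m by exact: dist_coef_ge0.
  have s0 : 0 <= slack r n k.+1 by exact: slack_ge0.
  apply: addr_ge0; [apply: addr_ge0|]; apply: mulr_ge0 => //.
  - by rewrite subr_ge0 dist_coef_le.
  - by apply: addr_ge0; [|apply: mulr_ge0 (ltW r0) _]; exact: Q_ge0.
  - by rewrite addr_ge0 ?mulr_ge0 ?w0 // ltW.
  - exact: Q_ge0.
have rec := dist_coef_rec r0 r1 kn; have curv := grad_coefS r0 k.
have sE m : slack r n m = grad_coef r m - dist_coef r n m.
  by rewrite /dist_coef; ring.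
rewrite /fan /Psi.
have -> : Y k = (1 + r) * Q n k + Y k.+1 by rewrite /Y big_ltn // mulrDr.
move: (Y k.+1) => Y'; rewrite !sE.
move: (dist_coef r n k) (dist_coef r n k.+1) (grad_coef r k) (grad_coef r k.+1)
  (n - k.+1)%:R rec curv => c c' D D' e rec curv.
(* With [u = p k - p k.+1], every inner product is expressed through [g k], [z k] and [u]. *)
have [u uE] : exists u, u = r *: g k + g k.+1 by eexists.
have zS : z k.+1 = z k - u.
  by rewrite uE /z /p xS //; apply/rowP => i; rewrite !mxE; ring.
have gS : g k.+1 = u - r *: g k by rewrite uE addrAC subrr add0r.
have pkS : p k - p k.+1 = u.
  by rewrite -(subKr (z k) u) -zS /z; apply/rowP => i; rewrite !mxE; ring.
have Q1 : Q k k.+1 = phi k - phi k.+1 - dot (u - r *: g k) u.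
  by rewrite /Q pkS -gS.
have Q2 : Q k.+1 k = phi k.+1 - phi k + dot (g k) u.
  by rewrite /Q -pkS -[p k.+1 - _]opprB dotNr opprK.
have Q3 : Q n k = phi n - phi k + dot (g k) (z k).
  by rewrite /Q -[p n - _]opprB dotNr opprK.
rewrite Q1 Q2 Q3 zS gS; move: (g k) (z k) => gk zk.
rewrite !dotE (dotC u gk) (dotC u zk).
(* Once [D] is eliminated all inner products cancel, and only a multiple of [phi k - phi n]
   remains. *)
have DE : D = r ^+ 2 * D' - (1 - r) / 2 by rewrite curv; ring.
rewrite {}DE in rec *; apply/eqP; rewrite -subr_eq0; apply/eqP.
rewrite [LHS](_ : _ = (phi k - phi n) * (1 - ((1 + r) * (e * c' - (e + 2) * c) +
  (1 - r) * (D' - (r ^+ 2 * D' - (1 - r) / 2))))); last by field.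
by rewrite rec subrr mulr0.
Qed.

Lemma certificate :
  grad_coef r n * dot (g n) (g n)
  <= \sum_(0 <= k < n) (phi k - phi n + (1 - r) / 2 * dot (g k) (g k)).
Proof.
have dot00 (v : 'rV[R]_d) : dot v 0 = 0 by rewrite dotC dot0l.
have : forall k, (k <= n)%N -> 0 <=
    \sum_(0 <= j < k) (phi j - phi n + (1 - r) / 2 * dot (g j) (g j))
    + (Psi k + dist_coef r n k * Y k).
  elim=> [|k IH] kn.
    have w0 := dist_coef0 r0 rn.
    have c0 : grad_coef r 0 = 0 by rewrite /grad_coef expr0 subrr mul0r.
    have s0 : slack r n 0 = 0.
      rewrite -[slack _ _ _](subKr (grad_coef r 0)) -/(dist_coef r n 0).
      by rewrite w0 c0 subr0.
    by rewrite big_nil /Psi w0 c0 s0 !(mulr0, mul0r, subr0, addr0).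
  apply: le_trans (IH (ltnW kn)) _; rewrite big_nat_recr //= -!addrA lerD2l.
  by have := potential_step kn; rewrite -!addrA.
move=> /(_ n (leqnn n)); rewrite /Psi /Y /z !subrr.
rewrite [\sum_(n <= _ < n) _]big_geq // !dot00.
by rewrite !(mulr0, subr0, addr0, sub0r) subr_ge0.
Qed.

End Certificate.

(* With [p k = x k - g k] and [phi k = F k - |g k|^2 / 2] (the function whose
   Moreau envelope is [F]) the interpolation inequality becomes the subgradient
   inequality [phi i >= phi j + <g j, p i - p j>]. *)
Lemma sum_gap_ge (R : realFieldType) (r : R) (d n : nat)
    (x g : nat -> 'rV[R]_d) (F : nat -> R) :
  0 < r -> r < 1 -> r ^+ n * (1 + n%:R * (1 + r)) = 1 ->
  (forall k, (k < n)%N -> x k.+1 = x k - (1 + r) *: g k) ->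
  (forall i j, (i <= n)%N -> (j <= n)%N ->
     dot (g j) (x i - x j) + dot (g i - g j) (g i - g j) / 2 <= F i - F j) ->
  r / 2 * \sum_(0 <= k < n) dot (g k) (g k)
  + n%:R * r ^- n / 2 * dot (g n) (g n) <= \sum_(0 <= k < n) (F k - F n).
Proof.
move=> r0 r1 rn xS interp.
pose phi k := F k - dot (g k) (g k) / 2.
have phi_ge i j : (i <= n)%N -> (j <= n)%N ->
    0 <= phi i - phi j - dot (g j) ((x i - g i) - (x j - g j)).
  move=> iN jN; have := interp i j iN jN; rewrite -subr_ge0; congr (0 <= _).
  by rewrite /phi !dotE (dotC (g i) (g j)); field.
have := certificate r0 r1 rn xS phi_ge.
have -> : \sum_(0 <= k < n) (phi k - phi n + (1 - r) / 2 * dot (g k) (g k)) =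
  \sum_(0 <= k < n) (F k - F n) - r / 2 * \sum_(0 <= k < n) dot (g k) (g k)
  + n%:R / 2 * dot (g n) (g n).
  rewrite mulr_sumr -sumrB.
  rewrite [n%:R / 2 * _](_ : _ = \sum_(0 <= k < n) (dot (g n) (g n) / 2)).
    by rewrite -big_split; apply: eq_bigr => k _ /=; rewrite /phi; field.
  by rewrite sumr_const_nat subn0 -mulr_natl; field.
rewrite grad_coef_balanced //.
move: (r ^- n) => rho; rewrite -subr_ge0 => H; rewrite -subr_ge0.
by move: H; congr (0 <= _); field.
Qed.

(** * The interpolation inequality of smooth convex functions *)

Section Interpolation.
Variables (R : realType) (d : nat).
Implicit Types x y v w : 'rV[R]_d.

Lemma dotxx_ge0 x : 0 <= dot x x.
Proof. by apply: sumr_ge0 => i _; rewrite -expr2 sqr_ge0. Qed.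

Lemma enorm_sqr x : enorm x ^+ 2 = dot x x.
Proof.
have -> : dot x x = \sum_i x ord0 i ^+ 2.
  by apply: eq_bigr => i _; rewrite expr2.
by rewrite sqr_sqrtr // sumr_ge0 // => i _; rewrite sqr_ge0.
Qed.

Variable f : 'rV[R]_d -> R.
Hypothesis f01 : F01 f.

Lemma grad_lipschitz_sqr x y :
  dot (grad f x - grad f y) (grad f x - grad f y) <= dot (x - y) (x - y).
Proof.
by rewrite -!enorm_sqr lerXn2r ?nnegrE ?sqrtr_ge0 //; apply: F01_grad_lipschitz.
Qed.

Lemma is_derive_line x v (t : R) :
  is_derive t 1 (fun s : R => f (x + s *: v)) (dot (grad f (x + t *: v)) v).
Proof.
have df : differentiable f (x + t *: v) by exact: F01_differentiable.
set a := x + t *: v.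
have E : (fun e : R =>
      e^-1 *: (((fun s : R => f (x + s *: v)) \o shift t) (e *: 1) - f a))
    = (fun e : R => e^-1 *: ((f \o shift a) (e *: v) - f a)).
  apply/funext => e /=; congr (_ *: (f _ - _)).
  by rewrite [e *: 1]mulr1 scalerDl addrCA.
have dv : derivable f (x + t *: v) v by exact: diff_derivable.
split; first by rewrite /derivable E.
have -> : dot (grad f (x + t *: v)) v = 'D_v f (x + t *: v).
  by rewrite deriveE // diff_grad.
by rewrite /derive E.
Qed.

(** The sign [s] selects one half of the absolute value; for each, [F] has nonpositive derivative at
    [t > 0], so [F 1 <= F 0]. *)
Lemma descent_abs x v :
  `|f (x + v) - f x - dot (grad f x) v| <= dot v v / 2.
Proof.
suff H (s : R) : s ^+ 2 = 1 ->
    s * (f (x + v) - f x - dot (grad f x) v) <= dot v v / 2.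
  have := H 1 (expr1n _ _); have := H (-1) (sqrr_sign _ 1).
  by rewrite ler_norml; lra.
move=> s2.
pose F (t : R) :=
  s * (f (x + t *: v) - t * dot (grad f x) v) - t ^+ 2 * (dot v v / 2).
pose dF (t : R) :=
  s * (dot (grad f (x + t *: v)) v - dot (grad f x) v) - t * dot v v.
have FE (t : R) : is_derive t 1 F (dF t).
  have := is_derive_line x v t => H.
  rewrite /F /dF; apply: is_derive_eq.
  by rewrite /GRing.scale /=; field.
have derF (t : R) : derivable F t 1 by case: (FE t).
have dF_le0 (t : R) : 0 < t -> derive1 F t <= 0.
  move=> t0; rewrite derive1E derive_val /dF -dotNl -dotDl.
  have := grad_lipschitz_sqr (x + t *: v) x.
  rewrite [x + _ - x]addrAC subrr add0r; move: (grad f _ - _) => a aa.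
  (* This square replaces Cauchy-Schwarz: with [|a|^2 <= t^2 |v|^2] it gives
     [s <a, v> <= t |v|^2]. *)
  have := dotxx_ge0 (a - (s * t) *: v).
  rewrite -(pmulr_rle0 _ t0); move: aa; rewrite !dotE (dotC v a).
  have -> : s * t * (s * t * dot v v) = s ^+ 2 * t ^+ 2 * dot v v by ring.
  rewrite s2; lra.
have : F 1 <= F 0.
  apply: (@ler0_derive1_nincr R F 0 1) => //.
  - by move=> t; rewrite in_itv /= => /andP[t0 _]; exact: dF_le0.
  - by apply: derivable_within_continuous => t _; exact: derF.
rewrite /F scale1r scale0r addr0; lra.
Qed.

(* Convexity along [x + t v] is compared with the lower half of [descent_abs],
   then [t] is taken small. *)
Lemma convex_gradient x y : f x + dot (grad f x) (y - x) <= f y.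
Proof.
have [v ->] : exists v, y = x + v by exists (y - x); rewrite addrC subrK.
rewrite [x + v - x]addrAC subrr add0r.
have small (t : R) : 0 < t -> t <= 1 ->
    dot (grad f x) v - (f (x + v) - f x) <= t * (dot v v / 2).
  move=> t0 t1; have := descent_abs x (t *: v).
  rewrite ler_norml => /andP[+ _].
  have -> : x + t *: v = t *: (x + v) + (1 - t) *: x.
    by apply/rowP => i; rewrite !mxE; ring.
  have := F01_convex f01 (Itv01 (ltW t0) t1) (x := x + v) (y := x).
  rewrite !in_setT => /(_ isT isT) H.
  have {}H : f (t *: (x + v) + (1 - t) *: x) <= t * f (x + v) + (1 - t) * f x.
    exact: H.
  by rewrite !dotE => H'; rewrite -(ler_pM2l t0); lra.
have b0 : 0 <= dot v v / 2 by rewrite divr_ge0 ?dotxx_ge0.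
move: (dot v v / 2) b0 small => b b0 small; rewrite addrC -lerBrDr -subr_le0.
move: (_ - _) small => c small; rewrite leNgt; apply/negP => c0.
have cb : 0 < c + b by rewrite ltr_wpDr.
(* This [t] is at most 1 and also covers [b = 0]; it would give [c + b <= b]. *)
have := small (c / (c + b)) (divr_gt0 c0 cb).
rewrite ler_pdivrMr // mul1r lerDl => /(_ b0).
by rewrite mulrAC ler_pdivlMr // ler_pM2l // gerDr leNgt c0.
Qed.

(** At the point [x - e], the tangent at [y] bounds [f] from below and the quadratic bound at [x]
    bounds it from above. *)
Lemma F01_interpolation x y :
  dot (grad f y) (x - y) + dot (grad f x - grad f y) (grad f x - grad f y) / 2
  <= f x - f y.
Proof.
set e := grad f x - grad f y.
have := convex_gradient y (x - e).
have := descent_abs x (- e); rewrite ler_norml => /andP[_].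
rewrite (_ : x - e - y = (x - y) - e); last by rewrite addrAC.
rewrite !dotE.
have : dot e e = dot (grad f x) e - dot (grad f y) e by rewrite -dotNl -dotDl.
lra.
Qed.
End Interpolation.

(** * The minimizer and the final rate *)

Lemma argmin_grad (R : realType) (d : nat) (f : 'rV[R]_d -> R) (xs : 'rV[R]_d) :
  F01 f -> argmin f xs -> grad f xs = 0.
Proof.
move=> f01 fxs; set g := grad f xs.
have gg : dot g g <= 0.
  (* A unit gradient step from [xs] would lower [f] by at least [|g|^2 / 2]. *)
  have := descent_abs f01 xs (- g); rewrite ler_norml => /andP[_].
  by rewrite -/g !dotE; have := fxs (xs - g); lra.
have /eqP : dot g g = 0 by apply/eqP; rewrite eq_le gg dotxx_ge0.
rewrite psumr_eq0 => [/allP g0|i _]; last by rewrite -expr2 sqr_ge0.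
apply/rowP => i; rewrite [RHS]mxE; apply/eqP.
by have := g0 i (mem_index_enum i); rewrite /= mulf_eq0 orbb.
Qed.

(** The sum of squared gradients occurs with the same weight [r / 2] in [upper] and in [lower], so
    it cancels. Scaling by [(1 + r) * eta ^+ 2] then gives the rate. *)
Lemma constant_step_rate (R : realType) (n : nat) (r : R) (d : nat)
    (f : 'rV[R]_d -> R) (xs : 'rV[R]_d) (x : nat -> 'rV[R]_d) :
  is_rstar n r -> F01 f -> argmin f xs ->
  (forall k, (k < n)%N -> x k.+1 = x k - (1 + r) *: grad f (x k)) ->
  (1 - r ^+ n) / 2 * enorm (grad f (x n)) ^+ 2
  + (r ^+ n) ^+ 2 / 2 * enorm (x n - xs) ^+ 2
  + r ^+ n * (1 - r ^+ n) * (f (x n) - minval f)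
  <= (r ^+ n) ^+ 2 / 2 * enorm (x 0%N - xs) ^+ 2.
Proof.
move=> [/andP[r0 r1] rn] f01 fxs xS.
rewrite (minvalE fxs) !enorm_sqr.
have interp i j (_ : (i <= n)%N) (_ : (j <= n)%N) :=
  F01_interpolation f01 (x i) (x j).
have lower := sum_gap_ge (F := f \o x) r0 r1 rn xS interp.
have h0 : 0 < 1 + r by rewrite addr_gt0.
have eta0 : 0 < r ^+ n by rewrite exprn_gt0.
have upper : \sum_(0 <= k < n) (f (x k) - f xs) <=
  (dot (x 0%N - xs) (x 0%N - xs) - dot (x n - xs) (x n - xs)) / (2 * (1 + r))
  + r / 2 * \sum_(0 <= k < n) dot (grad f (x k)) (grad f (x k)).
  pose D k := - (dot (x k - xs) (x k - xs) / (2 * (1 + r))).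
  have -> : (dot (x 0%N - xs) (x 0%N - xs) - dot (x n - xs) (x n - xs))
      / (2 * (1 + r)) = D n - D 0%N by rewrite /D; field; rewrite gt_eqF.
  rewrite -telescope_sumr // mulr_sumr -big_split /= big_nat [leRHS]big_nat.
  apply: ler_sum => k /andP[_ kn]; have := F01_interpolation f01 xs (x k).
  rewrite (argmin_grad f01 fxs) sub0r.
  have -> : D k.+1 - D k = dot (grad f (x k)) (x k - xs)
      - (1 + r) / 2 * dot (grad f (x k)) (grad f (x k)).
    rewrite /D xS // addrAC; move: (x k - xs) (grad f _) => y g.
    by rewrite !dotE (dotC y g); field; rewrite gt_eqF.
  by rewrite !dotE; lra.
have sumE : \sum_(0 <= k < n) (f (x k) - f xs) =
  \sum_(0 <= k < n) (f (x k) - f (x n)) + n%:R * (f (x n) - f xs).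
  rewrite -[n in n%:R]subn0 mulr_natl -sumr_const_nat -big_split /=.
  by apply: eq_bigr => k _; rewrite addrA subrK.
rewrite sumE in upper; move: lower upper => /=.
(* In this form the balance yields the factors [1 - eta] of the rate. *)
have eta1 : n%:R * (1 + r) * r ^+ n = 1 - r ^+ n.
  by rewrite -[1 in RHS]rn; ring.
have etaN0 : r ^+ n != 0 by rewrite gt_eqF.
move: (\sum_(0 <= k < n) _) (\sum_(0 <= k < n) _) (dot _ _) (dot _ _) (dot _ _)
  (f _ - f _) (r ^+ n) eta1 eta0 etaN0
  => S T A B C M eta eta1 eta0 etaN0 lower upper.
have : n%:R * M + n%:R / eta / 2 * C <= (B - A) / (2 * (1 + r)) by lra.
rewrite -(ler_pM2l (mulr_gt0 h0 (exprn_gt0 2 eta0))).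
have -> : (1 + r) * eta ^+ 2 * (n%:R * M + n%:R / eta / 2 * C) =
    n%:R * (1 + r) * eta * (eta * M + C / 2) by field.
have -> : (1 + r) * eta ^+ 2 * ((B - A) / (2 * (1 + r)))
    = eta ^+ 2 / 2 * (B - A).
  by field; rewrite gt_eqF.
by rewrite eta1; lra.
Qed.

Unset Implicit Arguments.

Theorem theorem2 (R : realType) (n : nat) (hn : (1 <= n)%N) :
  s_composable (nseq n (hstar R n)) (etastar R n) /\
  (forall (d : nat) (f : 'rV[R]_d -> R) (xs : 'rV[R]_d) (x : nat -> 'rV[R]_d),
     F01 f -> argmin f xs ->
     (forall i : nat, (i < n)%N ->
        x i.+1 = x i - hstar R n *: grad f (x i)) ->
     (1 - etastar R n) / 2 * enorm (grad f (x n)) ^+ 2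
     + etastar R n ^+ 2 / 2 * enorm (x n - xs) ^+ 2
     + etastar R n * (1 - etastar R n) * (f (x n) - minval f)
     <= etastar R n ^+ 2 / 2 * enorm (x 0%N - xs) ^+ 2).
Proof.
have rP := rstarP R hn; have [/andP[r0 r1] rn] := rP.
have rate := constant_step_rate rP; split; last exact: rate.
split; rewrite ?size_nseq.
- by move=> t; rewrite mem_nseq => /andP[_ /eqP->]; rewrite addr_gt0.
- rewrite big_nseq iter_addr addr0 -mulr_natl /hstar /etastar.
  have E0 : 1 + n%:R * (1 + rstar R n) != 0.
    by apply: contra_eq_neq rn => ->; rewrite mulr0 eq_sym oner_neq0.
  by apply: (mulIf E0); rewrite rn divfK.
- by rewrite big_nseq iter_mulr mulr1 /hstar addrAC subrr add0r.
- move=> d f xs x f01 fxs traj; apply: rate => // k kn.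
  by rewrite traj ?size_nseq ?nth_nseq ?kn.
Qed.
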